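(* Let $d\ge2$ be an integer and let $p,n$ be real with $p\ge n>d/2$. For each $\ell\in\{1,2,3,\dots\}$ one has $K_{pn}\ge K^{\{-\}}_{pn}(\ell)$, where $$K^{\{-\}}_{pn}(\ell):=\frac{\sqrt2}{(2\pi)^{d/2}}\,\frac{\sqrt{1+(1+4\ell^2)^p}}{\ell^p(1+\ell^2)^{n/2+1/2}+\ell^n(1+\ell^2)^{p/2+1/2}}\qquad\text{if }d\ge3,$$ $$K^{\{-\}}_{pn}(\ell):=\frac{\sqrt2}{2\pi}\,\frac{\sqrt{1+(1+2\ell^2)^2(1+4\ell^2)^{p-1}}}{\ell^p(1+\ell^2)^{n/2+1}+\ell^n(1+\ell^2)^{p/2+1}}\qquad\text{if }d=2.$$ Thus $K_{pn}\ge K^{\{-\}}_{pn}:=\sup_{\ell\in\{1,2,3,\dots\}}K^{\{-\}}_{pn}(\ell)$.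
   Context: Notation. $\mathbf T^d=(\mathbf R/2\pi\mathbf Z)^d$; $e_k(x)=(2\pi)^{-d/2}e^{ik\cdot x}$ for $k\in\mathbf Z^d$; $a\cdot b=\sum_ra_rb_r$ and $|a|=\sqrt{\overline a\cdot a}$ on $\mathbf C^d$; $\mathbf Z^d_0=\mathbf Z^d\setminus\{0\}$. An $\mathbf R^d$-valued distribution on $\mathbf T^d$ has a Fourier expansion $v=\sum_kv_ke_k$, $v_k=\overline{v_{-k}}\in\mathbf C^d$. For real $m$, $\mathbb H^m$ is the space of such $v$ with $k\cdot v_k=0$ for all $k$, $v_0=0$ and $\|v\|_m^2:=\sum_{k\in\mathbf Z^d_0}|k|^{2m}|v_k|^2<\infty$. The Leray projection $\mathfrak L$ acts by $(\mathfrak Lv)_k=v_k-\frac{k\cdot v_k}{|k|^2}k$ for $k\ne0$, $(\mathfrak Lv)_0=v_0$. $\mathcal P(v,w)=\mathfrak L(v\cdot\partial w)$, $(v\cdot\partial w)_s=\sum_{r=1}^dv_r\partial_rw_s$; for $p>d/2$ it maps $\mathbb H^p\times\mathbb H^{p+1}$ to $\mathbb H^p$. For $p\ge n>d/2$, $K_{pn}$ is the sharp (i.e. minimum) constant $K$ such that $\|\mathcal P(v,w)\|_p\le\frac12K(\|v\|_p\|w\|_{n+1}+\|v\|_n\|w\|_{p+1})$ for all $v\in\mathbb H^p$, $w\in\mathbb H^{p+1}$ (such constants exist). *)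

(* Defs.v *)
From mathcomp Require Export all_boot all_order all_algebra.
From mathcomp Require Export complex.
From mathcomp Require Export all_classical all_reals all_analysis.
Export Order.TTheory GRing.Theory Num.Theory.
Export numFieldNormedType.Exports.

Set Implicit Arguments.
Unset Strict Implicit.
Unset Printing Implicit Defensive.

Local Open Scope classical_set_scope.
Local Open Scope ring_scope.
Local Open Scope complex_scope.

Section TorusDistributions.
Context {R : realType}.

Definition cdot {d : nat} (a b : 'rV[R[i]]_d) : R[i] :=
  \sum_(r < d) a 0 r * b 0 r.

Definition cvec_conj {d : nat} (a : 'rV[R[i]]_d) : 'rV[R[i]]_d :=
  map_mx (fun z : R[i] => z^*) a.

(* [cdot (cvec_conj a) a] is a nonnegative real, so taking its real part only
   changes its type. *)
Definition vnorm {d : nat} (a : 'rV[R[i]]_d) : R :=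
  Num.sqrt (complex.Re (cdot (cvec_conj a) a)).

Definition zvec {d : nat} (k : 'rV[int]_d) : 'rV[R[i]]_d :=
  map_mx (fun z : int => z%:~R) k.

(* The point x of the torus is given by representatives of its coordinates
   modulo 2 pi. *)
Definition expi {d : nat} (k : 'rV[int]_d) (x : 'rV[R]_d) : R[i] :=
  let kx := \sum_(r < d) (k 0 r)%:~R * x 0 r in
  ((2 * pi) `^ (- (d%:R / 2)))%:C * (cos kx +i* sin kx).

(* A C^d-valued distribution on the torus is identified with the family
   (v_k) of its Fourier coefficients with respect to the functions e_k. *)
Definition family (d : nat) := 'rV[int]_d -> 'rV[R[i]]_d.

(* The families arising from R^d-valued distributions are those of at most
   polynomial growth which satisfy the reality condition. *)
Definition real_distribution {d : nat} (v : family d) : Prop :=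
  (exists (C : R) (N : nat), forall k,
     vnorm (v k) <= C * (1 + vnorm (zvec k)) ^+ N) /\
  (forall k, v k = cvec_conj (v (- k))).

Definition sobolev_sqnorm {d : nat} (m : R) (v : family d) : \bar R :=
  (\esum_(k in [set k : 'rV[int]_d | k != 0%R])
     (vnorm (zvec k) `^ (2 * m) * vnorm (v k) ^+ 2)%:E)%E.

Definition sobolev_norm {d : nat} (m : R) (v : family d) : \bar R :=
  sqrte (sobolev_sqnorm m v).

Definition HH {d : nat} (m : R) : set (family d) :=
  [set v | [/\ real_distribution v,
               forall k, cdot (zvec k) (v k) = 0,
               v 0 = 0 &
               (sobolev_sqnorm m v < +oo)%E]].

Definition leray {d : nat} (v : family d) : family d := fun k =>
  if k == 0 then v k
  else v k - (cdot (zvec k) (v k) / (vnorm (zvec k) ^+ 2)%:C) *: zvec k.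

(* Unordered sums of absolutely summable families. *)
Definition rsum {I : choiceType} (f : I -> R) : R :=
  fine (\esum_(i in [set: I]) (Num.max (f i) 0)%:E)%E -
  fine (\esum_(i in [set: I]) (Num.max (- f i) 0)%:E)%E.

Definition csum {I : choiceType} (f : I -> R[i]) : R[i] :=
  rsum (fun i => complex.Re (f i)) +i* rsum (fun i => complex.Im (f i)).

(* The function x |-> sum_k v_k e_k(x). For v in H^m with m > d/2 this series
   converges absolutely and uniformly, and its sum is the continuous function
   which represents the distribution v. *)
Definition realization {d : nat} (v : family d) (x : 'rV[R]_d) : 'rV[R[i]]_d :=
  \row_(s < d) csum (fun k => v k 0 s * expi k x).

(* The r-th distributional derivative, read on Fourier coefficients. *)
Definition partial {d : nat} (r : 'I_d) (w : family d) : family d := fun k =>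
  ('i * (k 0 r)%:~R) *: w k.

(* The integral over [0, 2 pi]^d as an iterated integral; by Fubini this is the
   integral over the torus for continuous functions, the only ones it is
   applied to below when p > d/2. *)
Fixpoint box_integral {d : nat} : ('rV[R]_d -> R) -> R :=
  match d with
  | 0 => fun f => f 0
  | d'.+1 => fun f =>
      (\int[lebesgue_measure]_(t in `[0%R, (2 * pi)%R])
         box_integral (fun x : 'rV[R]_d' =>
           f (row_mx (const_mx t : 'rV[R]_1) x : 'rV[R]_(1 + d'))))%R
  end.

Definition cbox_integral {d : nat} (f : 'rV[R]_d -> R[i]) : R[i] :=
  box_integral (fun x => complex.Re (f x)) +i*
  box_integral (fun x => complex.Im (f x)).

Definition fourier {d : nat} (f : 'rV[R]_d -> 'rV[R[i]]_d) : family d :=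
  fun k => \row_(s < d) cbox_integral (fun x => expi (- k) x * f x 0 s).

(* v . dw, as a product of functions. *)
Definition advection {d : nat} (v w : family d) : family d :=
  fourier (fun x => \row_(s < d)
    \sum_(r < d) realization v x 0 r * realization (partial r w) x 0 s).

Definition PP {d : nat} (v w : family d) : family d := leray (advection v w).

Definition admissible (d : nat) (p n K : R) : Prop :=
  forall v w : family d, HH p v -> HH (p + 1) w ->
  (sobolev_norm p (PP v w) <=
   (2^-1 * K)%:E * (sobolev_norm p v * sobolev_norm (n + 1) w +
                    sobolev_norm n v * sobolev_norm (p + 1) w))%E.

(* The infimum is taken in the extended reals, so that the definition does not
   depend on the existence of admissible constants; it is a minimum whenever
   it is finite, see [Ksharp_minimum]. *)
Definition Ksharp (d : nat) (p n : R) : \bar R :=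
  ereal_inf [set K%:E | K in [set K | admissible d p n K]].

Definition Kminus (d : nat) (p n : R) (l : nat) : R :=
  let L : R := l%:R in
  if d == 2%N then
    Num.sqrt 2 / (2 * pi) *
    (Num.sqrt (1 + (1 + 2 * L ^+ 2) ^+ 2 * (1 + 4 * L ^+ 2) `^ (p - 1)) /
     (L `^ p * (1 + L ^+ 2) `^ (n / 2 + 1) +
      L `^ n * (1 + L ^+ 2) `^ (p / 2 + 1)))
  else
    Num.sqrt 2 / (2 * pi) `^ (d%:R / 2) *
    (Num.sqrt (1 + (1 + 4 * L ^+ 2) `^ p) /
     (L `^ p * (1 + L ^+ 2) `^ (n / 2 + 2^-1) +
      L `^ n * (1 + L ^+ 2) `^ (p / 2 + 2^-1))).

Definition Kminus_sup (d : nat) (p n : R) : \bar R :=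
  ereal_sup [set (Kminus d p n l)%:E | l in [set l : nat | (0 < l)%N]].

Lemma zvec_norm_ge1 (d : nat) (k : 'rV[int]_d) : k != 0 -> 1 <= vnorm (zvec k).
Proof.
move=> k0; have [r kr0] : exists r, k 0 r != 0.
  apply/existsP; apply: contraNT k0; rewrite negb_exists => /forallP h.
  by apply/eqP/rowP => r; rewrite mxE; have := h r; rewrite negbK => /eqP.
rewrite /vnorm -[leLHS]sqrtr1 ler_wsqrtr// /cdot.
have -> : \sum_(i < d) (cvec_conj (zvec k)) 0 i * zvec k 0 i =
    (\sum_(i < d) ((k 0 i)%:~R ^+ 2 : R))%:C.
  rewrite rmorph_sum; apply: eq_bigr => i _; rewrite !mxE.
  by rewrite rmorphXn/= -[in LHS](rmorph_int (real_complex R)) conjc_real expr2.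
rewrite /= (bigD1 r)//= -[leLHS]addr0 lerD ?sumr_ge0// => [|i _]; last first.
  by rewrite sqr_ge0.
rewrite -rmorphXn/= -[leLHS]/(1%:~R) ler_int.
by rewrite -gtz0_ge1 exprn_even_gt0.
Qed.

Lemma sobolev_sqnorm_le (d : nat) (m m' : R) (v : family d) : m <= m' ->
  (sobolev_sqnorm m v <= sobolev_sqnorm m' v)%E.
Proof.
move=> mm'; apply: le_esum => k /= k0; rewrite lee_fin ler_wpM2r ?sqr_ge0//.
by rewrite ler_powR ?zvec_norm_ge1// ler_pM2l.
Qed.

Lemma sobolev_norm_fin (d : nat) (m : R) (v : family d) :
  (sobolev_sqnorm m v < +oo)%E -> sobolev_norm m v \is a fin_num.
Proof.
rewrite /sobolev_norm.
have : (0 <= sobolev_sqnorm m v)%E.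
  by apply: esum_ge0 => k _; rewrite lee_fin mulr_ge0 ?powR_ge0 ?sqr_ge0.
by case: (sobolev_sqnorm m v).
Qed.

Lemma Ksharp_minimum (d : nat) (p n K : R) : n <= p ->
  Ksharp d p n = K%:E <->
  (admissible d p n K /\ forall K', admissible d p n K' -> K <= K').
Proof.
move=> np; split=> [KE|[adm minK]]; last first.
  apply/eqP; rewrite eq_le; apply/andP; split.
    by apply: ereal_inf_lbound; exists K.
  by apply: le_ereal_inf_tmp => _ [K' /= /minK ? <-]; rewrite lee_fin.
split=> [v w Hv Hw|K' adm]; last first.
  by rewrite -lee_fin -KE; apply: ereal_inf_lbound; exists K'.
case: (Hv) => _ _ _ vp; case: (Hw) => _ _ _ wp.
have vn := le_lt_trans (sobolev_sqnorm_le v np) vp.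
have np1 : n + 1 <= p + 1 by rewrite lerD2r.
have wn := le_lt_trans (sobolev_sqnorm_le w np1) wp.
have fin0 m u : 0 <= fine (@sobolev_norm d m u).
  by apply: fine_ge0; apply: sqrte_ge0.
have [S S0 SE] : exists2 S : R, 0 <= S &
    (sobolev_norm p v * sobolev_norm (n + 1) w +
     sobolev_norm n v * sobolev_norm (p + 1) w = S%:E)%E.
  rewrite -(fineK (sobolev_norm_fin vp)) -(fineK (sobolev_norm_fin vn)).
  rewrite -(fineK (sobolev_norm_fin wp)) -(fineK (sobolev_norm_fin wn)).
  by rewrite -!EFinM -EFinD; eexists; last reflexivity; rewrite addr_ge0 ?mulr_ge0.
rewrite SE -EFinM; apply/lee_addgt0Pr => e e0.
have S1 : 0 < S + 1 by rewrite ltr_wpDl.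
have [_ [K' /= adm <-] K'lt] :
    exists2 x, [set K%:E | K in [set K | admissible d p n K]] x &
      (x < (K + 2 * (e / (S + 1)))%:E)%E.
  apply: ereal_inf_lt; rewrite -/(Ksharp d p n) KE lte_fin ltrDl.
  by rewrite mulr_gt0 ?divr_gt0.
apply: (le_trans (adm v w Hv Hw)); rewrite SE -EFinM -EFinD lee_fin.
apply: (@le_trans _ _ (2^-1 * (K + 2 * (e / (S + 1))) * S)).
  rewrite ler_wpM2r// ler_pM2l ?invr_gt0//.
  by rewrite -lee_fin ltW.
rewrite mulrDr mulKf// mulrDl lerD2l -mulrA ler_piMr ?ltW//.
by rewrite mulrC ltr_pdivrMr// mul1r ltrDl.
Qed.

End TorusDistributions.

(* Main.v *)
Require Import Defs.
From mathcomp Require Import ring lra zify.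

(** The lower bounds come from testing the inequality that defines [Ksharp] on
    a pair of standing waves. For nonzero a, b in Z^d with a <> b and a <> - b,
    and real vectors g, u with a . g = b . u = 0, let v have Fourier
    coefficient g at the modes a and - a, let w have coefficient u at b and
    - b, and let both vanish elsewhere. These fields belong to every H^m, with
    norms sqrt 2 |a|^m |g| and sqrt 2 |b|^m |u| ([sobolev_norm_wave]).

    The product v . dw only has the four modes obtained by adding one of a, - a
    to one of b, - b. They are nonzero and pairwise distinct
    ([wave_add_neq0], [wave_add_inj]), so that no two contributions interfere:
    at h + l the coefficient is (2 pi)^(- d / 2) i (g . l) u
    ([advection_wave]), and the Leray projection only keeps the part of u
    orthogonal to h + l. Bounding the norm of P(v, w) from below by the
    contribution of these modes gives an inequality satisfied by every
    admissible constant ([two_wave_bound]).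

    The stated bounds are the case a = (0, l, 0, ...), b = (1, l, 0, ...),
    g = (1, 0, ...), for which a + b = (1, 2 l, 0, ...) and
    b - a = (1, 0, ...). When d >= 3, u can be the third basis vector, which is
    orthogonal to all the modes, so that the Leray projection leaves the
    advection term unchanged. When d = 2 the only possible direction is
    u = (l, -1), and the Leray projection then loses the component of u along
    the modes; this is where the two formulas differ.

    The analytic work is to go through the definition of the product by
    pointwise multiplication of sums of Fourier series followed by integration
    over the torus. For fields with finitely many modes the series are
    trigonometric polynomials; these are integrated one variable at a time
    ([box_integral_trig]), and the Fourier coefficients of the product are the
    finite convolution [advection_finite]. *)

Set Implicit Arguments.
Unset Strict Implicit.
Unset Printing Implicit Defensive.

Local Open Scope classical_set_scope.
Local Open Scope ring_scope.
Local Open Scope complex_scope.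

(** * Unordered sums with finite support *)

Lemma esum_finite_support (R : realType) (I : choiceType) (D : set I)
    (s : seq I) (f : I -> R) :
  uniq s -> [set` s] `<=` D -> (forall i, D i -> 0 <= f i) ->
  (forall i, D i -> i \notin s -> f i = 0) ->
  (\esum_(i in D) (f i)%:E = (\sum_(i <- s) f i)%:E)%E.
Proof.
move=> us sD f0 fs; rewrite (esumID [set` s]); last first.
  by move=> i Di; rewrite lee_fin f0.
rewrite setIC (setIidl sD) [X in (_ + X)%E]esum1 ?adde0; last first.
  by move=> i [Di /negP si]; rewrite fs.
rewrite esum_fset//; last by move=> i /[!inE] si; rewrite lee_fin f0//; apply: sD.
by rewrite -fsbig_seq// sumEFin.
Qed.

Lemma csum_finite_support (R : realType) (I : choiceType) (s : seq I)
    (f : I -> R[i]) :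
  uniq s -> (forall i, i \notin s -> f i = 0) ->
  csum f = \sum_(i <- s) f i.
Proof.
move=> us fs.
have rs (g : I -> R) : (forall i, i \notin s -> g i = 0) ->
    rsum g = \sum_(i <- s) g i.
  move=> gs; rewrite /rsum !(esum_finite_support us)//=; first last.
  - by move=> i _ /gs ->; rewrite maxxx.
  - by move=> i _; rewrite le_max lexx orbT.
  - by move=> i _ /gs ->; rewrite oppr0 maxxx.
  - by move=> i _; rewrite le_max lexx orbT.
  rewrite -sumrB; apply: eq_bigr => i _.
  by case: (leP 0 (g i)) => h; case: (leP 0 (- g i)) => h'; lra.
rewrite /csum !rs; first last.
- by move=> i /fs ->.
- by move=> i /fs ->.
rewrite -(raddf_sum (@complex.Re R)) -(raddf_sum (@complex.Im R)).
by case: (\sum_(i <- s) f i).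
Qed.

(** * Integration of trigonometric polynomials *)

Lemma cos_sin_shift2pi (R : realType) (m : int) (x : R) :
  cos (m%:~R * (2 * pi) + x) = cos x /\ sin (m%:~R * (2 * pi) + x) = sin x.
Proof.
have E n y : y + n%:R * (2 * pi) = y + (pi *+ 2) *+ n :> R.
  by rewrite !mulr_natl.
have per n y : cos (n%:R * (2 * pi) + y) = cos y /\
    sin (n%:R * (2 * pi) + y) = sin y :> R.
  by rewrite addrC E (periodicn (@cosD2pi R)) (periodicn (@sinD2pi R)).
case: m => n; first exact: per.
(* A negative shift is undone by the opposite one. *)
have [<- <-] := per n.+1 ((Negz n)%:~R * (2 * pi) + x).
by rewrite NegzE mulrNz addrA -mulrDl pmulrn addrN mul0r add0r.
Qed.

(** The phase [ph] is a parameter because, when a function of several variables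
    is integrated over the last ones, the first coordinate enters as a phase. *)
Definition trig (R : realType) (m A B ph : R) (t : R) : R :=
  A * cos (m * t + ph) + B * sin (m * t + ph).

Lemma continuous_trig (R : realType) (m A B ph : R) :
  continuous (trig m A B ph : R -> R).
Proof.
move=> t; have ct : {for t, continuous (fun t : R => m * t + ph)}.
  by apply: cvgD; [apply: cvgM; [exact: cvg_cst|exact: cvg_id]|exact: cvg_cst].
apply: cvgD; apply: cvgM; try exact: cvg_cst.
- exact: (continuous_comp ct (@continuous_cos _ _)).
- exact: (continuous_comp ct (@continuous_sin _ _)).
Qed.

Lemma integrable_continuous (R : realType) (f : R -> R) (a b : R) :
  continuous f -> (@lebesgue_measure R).-integrable `[a, b] (EFin \o f).
Proof.
move=> cf; apply: continuous_compact_integrable; first exact: segment_compact.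
exact: continuous_subspaceT.
Qed.

(** For a nonzero frequency the antiderivative is again of the form [trig], and
    the integral over a whole number of its periods vanishes. *)
Lemma Rintegral_trig (R : realType) (m : int) (A B ph : R) :
  \int[lebesgue_measure]_(t in `[0%R, (2 * pi)%R]) trig m%:~R A B ph t =
  if m == 0 then 2 * pi * (A * cos ph + B * sin ph) else 0.
Proof.
have pi2 : 0 < 2 * pi :> R by rewrite mulr_gt0// pi_gt0.
case: eqVneq => [->|m0].
  under eq_Rintegral do rewrite /trig mul0r add0r.
  rewrite Rintegral_cst//= lebesgue_measure_itv/= lte_fin pi2 sube0 /=.
  by rewrite mulrC.
have m0' : m%:~R != 0 :> R by rewrite intr_eq0.
pose F := trig m%:~R (- B / m%:~R) (A / m%:~R) ph.
rewrite /Rintegral (@continuous_FTC2 _ _ F)//=.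
- rewrite /F /trig mulr0 add0r.
  by have [-> ->] := cos_sin_shift2pi m ph; rewrite subrr.
- exact/continuous_subspaceT/continuous_trig.
- split => [x _||].
  + by rewrite /F /trig; exact: ex_derive.
  + exact/cvg_at_right_filter/continuous_trig.
  + exact/cvg_at_left_filter/continuous_trig.
- move=> x _; rewrite derive1E /F /trig derive_val.
  rewrite /GRing.scale/=; field.
  done.
Qed.

Lemma continuous_sumr (R : realType) (I : Type) (s : seq I)
    (f : I -> R -> R) : (forall i, continuous (f i)) ->
  continuous (fun t => \sum_(i <- s) f i t).
Proof.
move=> cf; elim: s => [|j s IH] t.
  by under eq_fun do rewrite big_nil; exact: cvg_cst.
under eq_fun do rewrite big_cons.
by apply: cvgD; [exact: cf|exact: IH].
Qed.

Lemma Rintegral_sum_continuous (R : realType) (I : Type) (s : seq I)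
    (f : I -> R -> R) (a b : R) : (forall i, continuous (f i)) ->
  \int[lebesgue_measure]_(t in `[a, b]) (\sum_(i <- s) f i t) =
  \sum_(i <- s) \int[lebesgue_measure]_(t in `[a, b]) f i t.
Proof.
move=> cf; elim: s => [|i s IH].
  rewrite big_nil; under eq_Rintegral do rewrite big_nil.
  by rewrite Rintegral_cst// mul0r.
rewrite big_cons -IH -RintegralD//.
- by apply: eq_Rintegral => t _; rewrite big_cons.
- exact: integrable_continuous.
- by apply: integrable_continuous; exact: continuous_sumr.
Qed.

Definition phase (R : realType) (d : nat) (k : 'rV[int]_d) (x : 'rV[R]_d) : R :=
  \sum_(r < d) (k 0 r)%:~R * x 0 r.

Lemma phase_row_mx (R : realType) (d : nat) (k : 'rV[int]_(1 + d))
    (t : R) (x : 'rV[R]_d) :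
  phase k (row_mx (const_mx t : 'rV_1) x) =
  (k 0 0)%:~R * t + phase (rsubmx k) x.
Proof.
rewrite /phase big_split_ord/= big_ord1 row_mxEl mxE.
congr (_ * _ + _); first by congr (k _ _)%:~R; apply/val_inj.
by apply: eq_bigr => r _; rewrite row_mxEr mxE.
Qed.

(** Only the zero frequency survives. The statement is about sums of waves with
    arbitrary phases, since an induction on the dimension needs both: the
    integral over the last variables is taken at a fixed first coordinate, whose
    contribution to the argument is a phase, and its result must again be a
    finite sum to be integrated in that coordinate. *)
Lemma box_integral_trig (R : realType) (d : nat) (I : Type) (s : seq I)
    (k : I -> 'rV[int]_d) (A B ph : I -> R) :
  box_integral (fun x =>
    \sum_(i <- s) trig 1 (A i) (B i) (ph i) (phase (k i) x)) =
  \sum_(i <- s | k i == 0)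
    (2 * pi) ^+ d * (A i * cos (ph i) + B i * sin (ph i)).
Proof.
elim: d k ph => [|d IH] k ph /=.
  rewrite [RHS]big_mkcond; apply: eq_bigr => i _.
  by rewrite /phase big_ord0 /trig mulr0 add0r [k i]thinmx0 eqxx mul1r.
transitivity (\int[lebesgue_measure]_(t in `[0%R, (2 * pi)%R])
    \sum_(i <- [seq i <- s | rsubmx (k i : 'rV_(1 + d)) == 0])
      trig (k i 0 0)%:~R ((2 * pi) ^+ d * A i) ((2 * pi) ^+ d * B i) (ph i) t).
  apply: eq_Rintegral => t _.
  have := IH (fun i => rsubmx (k i : 'rV_(1 + d)))
    (fun i => (k i 0 0)%:~R * t + ph i).
  under [X in box_integral X]eq_fun => x.
    under eq_bigr do rewrite /trig mul1r addrCA addrA -phase_row_mx.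
    over.
  move=> IHt; under [X in box_integral X]eq_fun => x.
    under eq_bigr do rewrite /trig mul1r.
    over.
  rewrite IHt big_filter; apply: eq_bigr => i _.
  by rewrite /trig mulrDr !mulrA.
rewrite Rintegral_sum_continuous; last by move=> i; exact: continuous_trig.
rewrite (eq_bigr _ (fun i _ => Rintegral_trig _ _ _ _)).
rewrite big_filter -big_mkcondr/=; apply: eq_big => [i|i _]; last first.
  by rewrite exprSr; ring.
apply/andP/eqP => [[/eqP k1 /eqP k0]|->].
  apply/rowP => j; rewrite mxE.
  case: (splitP (j : 'I_(1 + d))) => j' jj'.
    rewrite -[RHS]k0; congr (k i _ _); apply/val_inj.
    by rewrite /= jj'; case: j' {jj'} => -[].
  move/rowP/(_ j'): k1; rewrite !mxE => <-; congr (k i _ _); exact/val_inj.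
by rewrite mxE; split => //; apply/eqP/rowP => j; rewrite !mxE.
Qed.

(** * The advection term of fields with finitely many modes *)

Definition torus_cst (R : realType) (d : nat) : R :=
  (2 * pi) `^ (- (d%:R / 2)).

Lemma torus_cst_sqr (R : realType) (d : nat) :
  torus_cst R d ^+ 2 * (2 * pi) ^+ d = 1.
Proof.
have pi2 : 0 < 2 * pi :> R by rewrite mulr_gt0// pi_gt0.
rewrite -powR_mulrn ?powR_ge0// -powRrM -powR_mulrn ?ltW// -powRD; last first.
  by rewrite (gt_eqF pi2) implybT.
by rewrite mulNr mulfVK// addNr powRr0.
Qed.

Lemma expi_def (R : realType) (d : nat) (k : 'rV[int]_d) (x : 'rV[R]_d) :
  expi k x = (torus_cst R d)%:C * (cos (phase k x) +i* sin (phase k x)).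
Proof. by []. Qed.

Lemma phaseD (R : realType) (d : nat) (h l : 'rV[int]_d) (x : 'rV[R]_d) :
  phase (h + l) x = phase h x + phase l x.
Proof.
by rewrite -big_split; apply: eq_bigr => r _; rewrite mxE intrD mulrDl.
Qed.

Lemma expiM (R : realType) (d : nat) (h l : 'rV[int]_d) (x : 'rV[R]_d) :
  expi h x * expi l x = (torus_cst R d)%:C * expi (h + l) x.
Proof.
rewrite !expi_def phaseD cosD sinD; set c := torus_cst R d.
by apply/eqP; rewrite eq_complex/=; apply/andP; split; apply/eqP; ring.
Qed.

Lemma cbox_integral_expi (R : realType) (d : nat) (I : Type) (s : seq I)
    (z : I -> R[i]) (k : I -> 'rV[int]_d) :
  cbox_integral (fun x => \sum_(j <- s) z j * expi (k j) x) =
  \sum_(j <- s | k j == 0) z j * ((2 * pi) ^+ d * torus_cst R d)%:C.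
Proof.
set c := torus_cst R d.
have ReE : (fun x => complex.Re (\sum_(j <- s) z j * expi (k j) x)) =
    (fun x => \sum_(j <- s)
      trig 1 (c * complex.Re (z j)) (- c * complex.Im (z j)) 0 (phase (k j) x)).
  apply/funext => x; rewrite (raddf_sum (@complex.Re R)).
  apply: eq_bigr => j _; rewrite expi_def /trig mul1r addr0 -/c.
  by case: (z j) => a b /=; ring.
have ImE : (fun x => complex.Im (\sum_(j <- s) z j * expi (k j) x)) =
    (fun x => \sum_(j <- s)
      trig 1 (c * complex.Im (z j)) (c * complex.Re (z j)) 0 (phase (k j) x)).
  apply/funext => x; rewrite (raddf_sum (@complex.Im R)).
  apply: eq_bigr => j _; rewrite expi_def /trig mul1r addr0 -/c.
  by case: (z j) => a b /=; ring.
rewrite /cbox_integral ReE ImE !box_integral_trig.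
apply/eqP; rewrite eq_complex/= (raddf_sum (@complex.Re R)).
rewrite (raddf_sum (@complex.Im R)) cos0 sin0.
apply/andP; split; apply/eqP; apply: eq_bigr => j _;
  by case: (z j) => a b /=; ring.
Qed.

Lemma realization_finite (R : realType) (d : nat) (S : seq 'rV[int]_d)
    (v : @family R d) (x : 'rV[R]_d) (s : 'I_d) :
  uniq S -> (forall k, k \notin S -> v k = 0) ->
  realization v x 0 s = \sum_(k <- S) v k 0 s * expi k x.
Proof.
move=> uS vS; rewrite mxE (csum_finite_support uS)// => k kS.
by rewrite vS// mxE mul0r.
Qed.

(** The product of [expi h] and [expi l] is a multiple of [expi (h + l)], so the
    pairs of modes with h + l = k are those that contribute at [k]. Three
    normalization constants appear, one for each exponential and one for the
    Fourier coefficient; two of them cancel the volume of the torus, which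
    leaves one. *)
Lemma advection_finite (R : realType) (d : nat) (S T : seq 'rV[int]_d)
    (v w : @family R d) (k : 'rV[int]_d) :
  uniq S -> uniq T -> (forall h, h \notin S -> v h = 0) ->
  (forall l, l \notin T -> w l = 0) ->
  advection v w k = \sum_(h <- S) \sum_(l <- T | h + l == k)
    ((torus_cst R d)%:C * 'i * cdot (v h) (zvec l)) *: w l.
Proof.
move=> uS uT vS wT; apply/rowP => s; rewrite /advection /fourier mxE.
set c := torus_cst R d.
pose z (q : 'rV[int]_d * 'rV[int]_d) :=
  c%:C ^+ 2 * 'i * cdot (v q.1) (zvec q.2) * w q.2 0 s.
transitivity (cbox_integral (fun x => \sum_(q <- [seq (h, l) | h <- S, l <- T])
    z q * expi (q.1 + q.2 - k) x)).
  congr cbox_integral; apply/funext => x; rewrite mxE big_allpairs/=.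
  under eq_bigr => r _.
    rewrite (realization_finite _ _ uS vS).
    rewrite (realization_finite (S := T))//; last first.
      by move=> l lT; rewrite /partial wT// scaler0.
    rewrite big_distrlr/=; over.
  rewrite exchange_big/= mulr_sumr; apply: eq_bigr => h _.
  rewrite exchange_big/= mulr_sumr; apply: eq_bigr => l _.
  rewrite (addrC _ (- k)) /z /cdot !mulr_sumr !mulr_suml/=.
  apply: eq_bigr => r _; rewrite !mxE.
  transitivity ('i * v h 0 r * (l 0 r)%:~R * w l 0 s *
      (expi (- k) x * (expi h x * expi l x))); first by ring.
  by rewrite (expiM h) [expi _ _ * _]mulrCA expiM -/c; ring.
rewrite cbox_integral_expi big_mkcond big_allpairs summxE/=.
apply: eq_bigr => h _; rewrite summxE -big_mkcond/=.
under eq_bigl do rewrite subr_eq0.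
apply: eq_bigr => l _; rewrite mxE /z/=.
rewrite -/c [LHS](_ : _ = (c ^+ 2 * (2 * pi) ^+ d)%:C *
   (c%:C * 'i * cdot (v h) (zvec l) * w l 0 s)).
  by rewrite torus_cst_sqr mul1r.
by rewrite !rmorphM !rmorphXn/=; ring.
Qed.

(** * Real amplitudes, Sobolev weights and the Leray projection *)

Definition rdot (R : realType) (d : nat) (g h : 'rV[R]_d) : R :=
  \sum_(r < d) g 0 r * h 0 r.

Definition cplx (R : realType) (d : nat) (g : 'rV[R]_d) : 'rV[R[i]]_d :=
  map_mx (real_complex R) g.

Definition rvec (R : realType) (d : nat) (k : 'rV[int]_d) : 'rV[R]_d :=
  map_mx intr k.

Definition zsq (R : realType) (d : nat) (k : 'rV[int]_d) : R :=
  rdot (rvec R k) (rvec R k).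

(** The squared length of the component of [u] orthogonal to [k]. *)
Definition leray_sq (R : realType) (d : nat) (k : 'rV[int]_d)
    (u : 'rV[R]_d) : R :=
  rdot u u - rdot (rvec R k) u ^+ 2 / zsq R k.

Section Algebra.
Context {R : realType} {d : nat}.
Implicit Types (g h u : 'rV[R]_d) (k l : 'rV[int]_d).

Lemma zvecE k : zvec k = cplx (rvec R k).
Proof. by apply/rowP => r; rewrite !mxE rmorph_int. Qed.

Lemma cdot_cplx g h : cdot (cplx g) (cplx h) = (rdot g h)%:C.
Proof. by rewrite rmorph_sum; apply: eq_bigr => r _; rewrite !mxE rmorphM. Qed.

Lemma sqr_vnorm (x : 'rV[R[i]]_d) :
  vnorm x ^+ 2 =
  \sum_(r < d) (complex.Re (x 0 r) ^+ 2 + complex.Im (x 0 r) ^+ 2).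
Proof.
rewrite /vnorm /cdot (raddf_sum (@complex.Re R)).
have E (r : 'I_d) : complex.Re (cvec_conj x 0 r * x 0 r) =
    complex.Re (x 0 r) ^+ 2 + complex.Im (x 0 r) ^+ 2.
  by rewrite mxE; case: (x 0 r) => p q /=; ring.
rewrite (eq_bigr _ (fun r _ => E r)).
by rewrite sqr_sqrtr// sumr_ge0// => r _; rewrite addr_ge0// sqr_ge0.
Qed.

Lemma vnorm_ge0 (x : 'rV[R[i]]_d) : 0 <= vnorm x.
Proof. exact: sqrtr_ge0. Qed.

Lemma sqr_vnormZ_cplx (z : R[i]) g :
  vnorm (z *: cplx g) ^+ 2 = (complex.Re z ^+ 2 + complex.Im z ^+ 2) * rdot g g.
Proof.
rewrite sqr_vnorm mulr_sumr; apply: eq_bigr => r _.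
by rewrite !mxE; case: z => p q /=; ring.
Qed.

Lemma sqr_vnorm_cplx g : vnorm (cplx g) ^+ 2 = rdot g g.
Proof.
by rewrite -[cplx g]scale1r sqr_vnormZ_cplx/= expr1n expr0n addr0 mul1r.
Qed.

Lemma vnorm_zvec_powR k (m : R) : vnorm (zvec k) `^ m = zsq R k `^ (m / 2).
Proof.
rewrite /zsq -sqr_vnorm_cplx -zvecE -powR_mulrn ?vnorm_ge0//.
by rewrite -powRrM mulrCA divff ?mulr1.
Qed.

Lemma zsqN k : zsq R (- k) = zsq R k.
Proof. by apply: eq_bigr => r _; rewrite !mxE mulrNz mulrNN. Qed.

Lemma zsq_gt0 k : k != 0 -> 0 < zsq R k.
Proof.
move=> k0; rewrite /zsq -sqr_vnorm_cplx -zvecE exprn_gt0//.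
by apply: lt_le_trans (zvec_norm_ge1 k0).
Qed.

Lemma rvecN k : rvec R (- k) = - rvec R k.
Proof. by apply/rowP => r; rewrite !mxE mulrNz. Qed.

Lemma rdotNl g h : rdot (- g) h = - rdot g h.
Proof.
rewrite /rdot -[RHS]mulN1r mulr_sumr; apply: eq_bigr => r _.
by rewrite !mxE mulN1r mulNr.
Qed.

Lemma rdotC g h : rdot g h = rdot h g.
Proof. by apply: eq_bigr => r _; rewrite mulrC. Qed.

Lemma leray_scale_cplx (v : family d) k (z : R[i]) u : k != 0 ->
  v k = z *: cplx u ->
  vnorm (leray v k) ^+ 2 = (complex.Re z ^+ 2 + complex.Im z ^+ 2) *
    leray_sq k u.
Proof.
rewrite /leray_sq => k0 vk; have q0 := zsq_gt0 k0.
have -> : leray v k =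
    z *: cplx (u - (rdot (rvec R k) u / zsq R k) *: rvec R k).
  rewrite /leray (negbTE k0) vk.
  have -> : vnorm (zvec k) ^+ 2 = zsq R k by rewrite zvecE sqr_vnorm_cplx.
  have -> : cdot (zvec k) (z *: cplx u) = z * (rdot (rvec R k) u)%:C.
    rewrite zvecE -cdot_cplx /cdot mulr_sumr; apply: eq_bigr => r _.
    by rewrite !mxE mulrCA.
  apply/rowP => r; rewrite !mxE rmorphB !rmorphM fmorphV/= rmorph_int.
  by ring.
rewrite sqr_vnormZ_cplx; congr (_ * _).
set s := _ / _.
have -> : rdot (u - s *: rvec R k) (u - s *: rvec R k) =
    rdot u u - 2 * s * rdot (rvec R k) u + s ^+ 2 * zsq R k.
  rewrite /rdot /zsq /rdot !mulr_sumr -sumrB -big_split/=.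
  by apply: eq_bigr => r _; rewrite !mxE; ring.
rewrite /s; field; exact: lt0r_neq0.
Qed.

End Algebra.

(** * Standing waves *)

Definition wave (R : realType) (d : nat) (a : 'rV[int]_d) (g : 'rV[R]_d) :
  @family R d := fun k => if k \in [:: a; - a] then cplx g else 0.

Lemma eq_opp_rV_int (d : nat) (x : 'rV[int]_d) : x = - x -> x = 0.
Proof.
move=> E; apply/rowP => r; move/rowP/(_ r): E.
by rewrite !mxE; move: (x 0 r) => z; lia.
Qed.

Lemma uniq_opp (d : nat) (a : 'rV[int]_d) : a != 0 -> uniq [:: a; - a].
Proof.
by move=> a0; rewrite /= inE andbT; apply: contra_neq a0; exact: eq_opp_rV_int.
Qed.

Section Wave.
Context {R : realType} {d : nat}.
Context (a : 'rV[int]_d) (g : 'rV[R]_d).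
Context (a0 : a != 0) (ga : rdot (rvec R a) g = 0).

Lemma sobolev_sqnorm_wave (m : R) :
  sobolev_sqnorm m (wave a g) = (2 * zsq R a `^ m * rdot g g)%:E.
Proof.
rewrite /sobolev_sqnorm (esum_finite_support (uniq_opp a0)).
- rewrite !big_cons big_nil addr0 /wave !inE !eqxx orbT.
  have := zsqN (R := R) a; rewrite !vnorm_zvec_powR => ->.
  by rewrite sqr_vnorm_cplx mulrAC divff// mul1r; congr EFin; ring.
- by move=> k /=; rewrite !inE => /orP[] /eqP ->//; rewrite oppr_eq0.
- by move=> k _; rewrite mulr_ge0 ?powR_ge0 ?sqr_ge0.
- move=> k _ ks; rewrite /wave (negbTE ks).
  rewrite sqr_vnorm big1 ?mulr0// => r _.
  by rewrite !mxE/= expr0n addr0.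
Qed.

Lemma sobolev_norm_wave (m : R) : sobolev_norm m (wave a g) =
  (Num.sqrt 2 * zsq R a `^ (m / 2) * Num.sqrt (rdot g g))%:E.
Proof.
rewrite /sobolev_norm sobolev_sqnorm_wave/= !sqrtrM ?mulr_ge0 ?powR_ge0//.
by rewrite -[Num.sqrt (_ `^ _)]powR12_sqrt ?powR_ge0// -powRrM.
Qed.

Lemma wave_HH (m : R) : HH m (wave a g).
Proof.
split.
- split.
    exists (vnorm (cplx g)), 0%N => k; rewrite expr0 mulr1 /wave.
    case: ifP => // _; rewrite -ler_sqr ?nnegrE ?vnorm_ge0//.
    rewrite sqr_vnorm big1 ?sqr_ge0// => r _.
    by rewrite !mxE/= expr0n addr0.
  move=> k; rewrite /wave !inE eqr_opp eqr_oppLR orbC; case: ifP => _.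
    by apply/rowP => r; rewrite !mxE/= oppr0.
  by apply/rowP => r; rewrite !mxE/= oppr0.
- move=> k; rewrite /wave !inE; case: ifP => [|_]; last first.
    by rewrite /cdot big1// => r _; rewrite !mxE mulr0.
  rewrite zvecE cdot_cplx => /orP[] /eqP ->; first by rewrite ga.
  by rewrite rvecN rdotNl ga oppr0.
- by rewrite /wave !inE (eq_sym 0 a) (eq_sym 0) oppr_eq0 (negbTE a0).
- by rewrite sobolev_sqnorm_wave ltry.
Qed.

End Wave.

(** * The bound given by two standing waves *)

Section TwoWaves.
Context {R : realType} {d : nat}.
Context (a b : 'rV[int]_d) (g u : 'rV[R]_d).
Context (a0 : a != 0) (b0 : b != 0) (ab : a != b) (abN : a != - b).
Context (ga : rdot (rvec R a) g = 0) (ub : rdot (rvec R b) u = 0).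

Lemma wave_add_neq0 h l : h \in [:: a; - a] -> l \in [:: b; - b] -> h + l != 0.
Proof.
rewrite !inE => /orP[] /eqP -> /orP[] /eqP ->.
- by rewrite addr_eq0.
- by rewrite subr_eq0.
- by rewrite addrC subr_eq0 eq_sym.
- by rewrite -opprD oppr_eq0 addr_eq0.
Qed.

(** If h' = - h, then either l' = l and 2 h = 0, or l' = - l and h + l is its
    own opposite; both are excluded, as Z^d has no 2-torsion. *)
Lemma wave_add_inj h l h' l' :
  h \in [:: a; - a] -> l \in [:: b; - b] ->
  h' \in [:: a; - a] -> l' \in [:: b; - b] ->
  h + l = h' + l' -> h = h' /\ l = l'.
Proof.
move=> hS lT h'S l'T E.
have [hh|hh] := eqVneq h h'; first by move: E; rewrite hh => /addrI ->.
have h'E : h' = - h.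
  move: hS h'S hh; rewrite !inE => /orP[] /eqP -> /orP[] /eqP ->//.
  - by rewrite eqxx.
  - by rewrite opprK.
  - by rewrite eqxx.
have l'E : l' = l \/ l' = - l.
  move: lT l'T; rewrite !inE => /orP[] /eqP -> /orP[] /eqP ->//;
    by rewrite ?opprK; auto.
case: l'E => l'E.
  move: E; rewrite h'E l'E => /addIr /eq_opp_rV_int h0.
  by move: hh; rewrite h'E h0 oppr0 eqxx.
have /eqP := wave_add_neq0 hS lT; case.
by apply: eq_opp_rV_int; rewrite opprD -l'E -h'E.
Qed.

(** By [wave_add_inj], a single pair of modes of the two waves contributes to
    the convolution at [h + l]. *)
Lemma advection_wave h l : h \in [:: a; - a] -> l \in [:: b; - b] ->
  advection (wave a g) (wave b u) (h + l) =
  ((torus_cst R d)%:C * 'i * (rdot g (rvec R l))%:C) *: cplx u.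
Proof.
move=> hS lT.
rewrite (advection_finite _ (uniq_opp a0) (uniq_opp b0)); last 2 first.
- by move=> k kS; rewrite /wave (negbTE kS).
- by move=> k kS; rewrite /wave (negbTE kS).
rewrite (bigD1_seq h hS (uniq_opp a0))/= -[RHS]addr0; congr (_ + _); last first.
  rewrite big_seq_cond big1// => h' /andP[h'S h'h].
  rewrite big_seq_cond big1// => l' /andP[l'T /eqP E].
  have [hh _] := wave_add_inj h'S l'T hS lT E.
  by rewrite hh eqxx in h'h.
under eq_bigl do rewrite (inj_eq (addrI h)).
rewrite -big_filter filter_pred1_uniq ?uniq_opp// big_seq1.
by rewrite /wave hS lT zvecE cdot_cplx.
Qed.

Lemma sqr_vnorm_PP_wave h l : h \in [:: a; - a] -> l \in [:: b; - b] ->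
  vnorm (PP (wave a g) (wave b u) (h + l)) ^+ 2 =
  (torus_cst R d * rdot g (rvec R b)) ^+ 2 * leray_sq (h + l) u.
Proof.
move=> hS lT; have hl0 := wave_add_neq0 hS lT.
rewrite /PP (leray_scale_cplx hl0 (advection_wave hS lT)); congr (_ * _).
rewrite /= !(mulr0, mul0r, subr0, oppr0, mulr1, addr0, add0r, expr0n)/=.
rewrite !exprMn; congr (_ * _).
move: lT; rewrite !inE => /orP[] /eqP ->//.
by rewrite rvecN rdotC rdotNl rdotC sqrrN.
Qed.

Lemma leray_sqN k : leray_sq (- k) u = leray_sq k u.
Proof. by rewrite /leray_sq zsqN rvecN rdotNl sqrrN. Qed.

(** The right-hand side is bounded from below by the sum over the four modes
    [h + l]; opposite modes carry the same weight, hence the factor 2. *)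
Lemma sobolev_sqnorm_PP_wave_ge (m : R) :
  ((2 * (torus_cst R d * rdot g (rvec R b)) ^+ 2 *
    (zsq R (a + b) `^ m * leray_sq (a + b) u +
     zsq R (a - b) `^ m * leray_sq (a - b) u))%:E <=
  sobolev_sqnorm m (PP (wave a g) (wave b u)))%E.
Proof.
pose ks := [seq h + l | h <- [:: a; - a], l <- [:: b; - b]].
have uks : uniq ks.
  apply: allpairs_uniq; rewrite ?uniq_opp// => -[h l] [h' l'].
  move=> /allpairsP[q [qS qT [-> ->]]] /allpairsP[q' [q'S q'T [-> ->]]] /= E.
  by have [-> ->] := wave_add_inj qS qT q'S q'T E.
apply: esum_ge; exists [set` ks].
  split; first exact: finite_seq.
  by move=> _ /= /allpairsP[[h l] /= [hS lT ->]]; exact: wave_add_neq0.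
rewrite -fsbig_seq// sumEFin lee_fin.
pose e k := zsq R k `^ m * leray_sq k u.
have eN k : e (- k) = e k by rewrite /e zsqN leray_sqN.
rewrite (eq_big_seq (fun k =>
    (torus_cst R d * rdot g (rvec R b)) ^+ 2 * e k)); last first.
  move=> _ /allpairsP[q [qS qT ->]]; rewrite sqr_vnorm_PP_wave// vnorm_zvec_powR.
  by rewrite mulrCA /e [2 * m]mulrC mulfK.
rewrite -/(e (a + b)) -/(e (a - b)).
move: (torus_cst R d * rdot g (rvec R b)) e eN {uks} => c e eN.
rewrite /ks /= 3!big_cons big_seq1 [- a + b]addrC -(opprB a b) -(opprD a b) !eN.
by rewrite le_eqVlt; apply/orP; left; apply/eqP; ring.
Qed.

(** The factors sqrt 2 of the two norms on the right-hand side of the defining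
    inequality absorb its factor 1 / 2. *)
Lemma two_wave_bound (p n K : R) : admissible d p n K ->
  Num.sqrt 2 * `|torus_cst R d * rdot g (rvec R b)| *
   Num.sqrt (zsq R (a + b) `^ p * leray_sq (a + b) u +
     zsq R (a - b) `^ p * leray_sq (a - b) u) <=
  K * (Num.sqrt (rdot g g) * Num.sqrt (rdot u u)) *
   (zsq R a `^ (p / 2) * zsq R b `^ ((n + 1) / 2) +
    zsq R a `^ (n / 2) * zsq R b `^ ((p + 1) / 2)).
Proof.
move=> /(_ _ _ (wave_HH a0 ga p) (wave_HH b0 ub (p + 1))).
rewrite !sobolev_norm_wave// => H.
rewrite -lee_fin; set rhs := (X in (_ <= X)%E); set lhs := (X in (X <= _)%E).
apply: (@le_trans _ _ (sobolev_norm p (PP (wave a g) (wave b u)))); last first.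
  apply: le_trans H _; rewrite /rhs -!EFinM lee_fin.
  have s2 : Num.sqrt 2 * Num.sqrt 2 = 2 :> R by rewrite -expr2 sqr_sqrtr.
  set x := Num.sqrt 2 in s2 *.
  rewrite le_eqVlt; apply/orP; left; apply/eqP.
  transitivity (2^-1 * (x * x) *
   (K * (Num.sqrt (rdot g g) * Num.sqrt (rdot u u)) *
   (zsq R a `^ (p / 2) * zsq R b `^ ((n + 1) / 2) +
    zsq R a `^ (n / 2) * zsq R b `^ ((p + 1) / 2)))); first by ring.
  by rewrite s2 mulVf ?mul1r.
rewrite /sobolev_norm.
have := sobolev_sqnorm_PP_wave_ge p; rewrite -(@lee_sqrt R); last first.
  by apply: esum_ge0 => k _; rewrite lee_fin mulr_ge0 ?powR_ge0 ?sqr_ge0.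
apply: le_trans; rewrite /lhs lee_fin sqrtrM ?(mulr_ge0 _ (sqr_ge0 _))//.
by rewrite sqrtrM// sqrtr_sqr.
Qed.

End TwoWaves.

(** * The choice of the waves *)

(** The modes are (0, l, 0, ...) and (1, l, 0, ...), and the first wave has
    amplitude (1, 0, ...); the amplitude of the second one is left free, so that
    the plane and the higher dimensions can be treated together. The last term
    under the square root comes from the mode (-1, 0, ...), whose Sobolev weight
    is 1. *)
Lemma planar_waves_bound (R : realType) (d l : nat) (u : 'rV[R]_d.+2)
    (p n K : R) :
  let L : R := l%:R in let u0 := u 0 0 in let u1 := u 0 1 in
  (0 < l)%N -> u0 + L * u1 = 0 -> admissible d.+2 p n K ->
  Num.sqrt 2 * torus_cst R d.+2 * Num.sqrt (
    (1 + 4 * L ^+ 2) `^ p *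
      (rdot u u - (u0 + 2 * L * u1) ^+ 2 / (1 + 4 * L ^+ 2)) +
    (rdot u u - u0 ^+ 2)) <=
  K * Num.sqrt (rdot u u) *
    (L `^ p * (1 + L ^+ 2) `^ ((n + 1) / 2) +
     L `^ n * (1 + L ^+ 2) `^ ((p + 1) / 2)).
Proof.
move=> L u0 u1 l0 uL adm.
pose pvec (x y : int) : 'rV[int]_d.+2 := \row_i [:: x; y]`_i.
have pdot x y (h : 'rV[R]_d.+2) :
    rdot (rvec R (pvec x y)) h = x%:~R * h 0 0 + y%:~R * h 0 1.
  rewrite /rdot !big_ord_recl big1 ?addr0; last first.
    by move=> i _; rewrite !mxE/= nth_nil mul0r.
  by rewrite !mxE/=; congr (_ + _ * h _ _); apply/val_inj.
have psq x y : zsq R (pvec x y) = x%:~R ^+ 2 + y%:~R ^+ 2.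
  by rewrite /zsq pdot !mxE/= !expr2.
pose a := pvec 0 l; pose b := pvec 1 l.
pose g : 'rV[R]_d.+2 := \row_i (i == 0)%:R.
have gdot (h : 'rV[R]_d.+2) : rdot g h = h 0 0.
  rewrite /rdot big_ord_recl big1 ?addr0 => [|i _]; rewrite !mxE/= ?mul1r//.
  by rewrite mul0r.
have abE : a + b = pvec 1 (2 * l%:Z).
  by apply/rowP => -[[|[|i]] ilt]; rewrite !mxE/= ?nth_nil//; lia.
have abE' : a - b = pvec (- 1) 0.
  by apply/rowP => -[[|[|i]] ilt]; rewrite !mxE/= ?nth_nil//; lia.
have neq x y x' y' : (x != x') || (y != y') -> pvec x y != pvec x' y'.
  apply: contraTneq => /rowP E.
  by have := E 0; have := E 1; rewrite !mxE/= => -> ->; rewrite !eqxx.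
have p0 : 0 = pvec 0 0 by apply/rowP => -[[|[|i]] ilt]; rewrite !mxE/= ?nth_nil.
have a0 : a != 0 by rewrite p0 neq//; apply/orP; right; lia.
have b0 : b != 0 by rewrite p0 neq.
have ab : a != b by rewrite neq.
have abN : a != - b.
  have -> : - b = pvec (- 1) (- l%:Z).
    by apply/rowP => -[[|[|i]] ilt]; rewrite !mxE/= ?nth_nil//; lia.
  by rewrite neq.
have ga : rdot (rvec R a) g = 0 by rewrite rdotC gdot !mxE.
have ub : rdot (rvec R b) u = 0 by rewrite pdot mul1r.
have := two_wave_bound a0 b0 ab abN ga ub adm.
rewrite abE abE' /leray_sq !psq !pdot !gdot !mxE/= -/u0 -/u1.
have -> : (2 * l%:Z)%:~R = 2 * L by rewrite intrM.
have Lpow m : (0%:~R ^+ 2 + L ^+ 2) `^ (m / 2) = L `^ m.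
  by rewrite expr0n add0r -powR_mulrn ?ler0n// -powRrM [2 * _]mulrC divfK.
rewrite -[l%:~R]/L !Lpow sqrtr1 mulr1 ger0_norm ?powR_ge0// !mul1r mul0r addr0.
rewrite mulN1r !sqrrN expr0n addr0 expr1n powR1 mul1r divr1 exprMn.
by rewrite -[2 ^+ 2]natrX.
Qed.

(** In the plane, u = (l, -1) has length sqrt (1 + l^2), which raises the
    exponents of 1 + l^2 by 1 / 2, and its squared component orthogonal to (1, 2 l) is
    (1 + 2 l^2)^2 / (1 + 4 l^2). In higher dimension u is a unit vector
    orthogonal to the plane of the modes. *)
Lemma Kminus_le_admissible (R : realType) (d l : nat) (p n K : R) :
  (2 <= d)%N -> (0 < l)%N -> admissible d p n K -> Kminus d p n l <= K.
Proof.
case: d => [|[|d]]// _ l0 adm; rewrite /Kminus; set L : R := l%:R.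
have L0 : 0 < L by rewrite ltr0n.
have q0 : 0 < 1 + L ^+ 2 by rewrite ltr_wpDr ?sqr_ge0.
have den_gt0 x y : 0 < L `^ p * (1 + L ^+ 2) `^ x + L `^ n * (1 + L ^+ 2) `^ y.
  by rewrite addr_gt0// mulr_gt0// powR_gt0.
case: d adm => [|d] adm /=.
  pose u : 'rV[R]_2 := \row_i [:: L; -1]`_i.
  have := planar_waves_bound (u := u) l0 _ adm; rewrite !mxE/= -/L.
  have -> : rdot u u = 1 + L ^+ 2.
    by rewrite /rdot !big_ord_recl big_ord0 !mxE/=; ring.
  have uL : L + L * -1 = 0 by ring.
  move=> /(_ uL); rewrite mulrA ler_pdivrMr//.
  have -> : torus_cst R 2 = (2 * pi)^-1.
    by rewrite /torus_cst divff// powR_inv1// mulr_ge0// pi_ge0.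
  have sq m : Num.sqrt (1 + L ^+ 2) * (1 + L ^+ 2) `^ ((m + 1) / 2) =
      (1 + L ^+ 2) `^ (m / 2 + 1).
    rewrite -powR12_sqrt ?ltW// -powRD ?(gt_eqF q0) ?implybT//.
    by congr (_ `^ _); field.
  set S := Num.sqrt (1 + L ^+ 2) in sq *.
  move=> H; apply: le_trans (le_trans H _); last first.
    by rewrite -!sq le_eqVlt; apply/orP; left; apply/eqP; ring.
  rewrite le_eqVlt; apply/orP; left; apply/eqP; congr (_ * Num.sqrt _).
  have r0 : 0 < 1 + 4 * L ^+ 2 by rewrite ltr_wpDr// mulr_ge0// sqr_ge0.
  have -> : (1 + 4 * L ^+ 2) `^ p =
      (1 + 4 * L ^+ 2) `^ (p - 1) * (1 + 4 * L ^+ 2).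
    rewrite -[X in _ = _ * X]powRr1 ?ltW// -powRD ?subrK//.
    by rewrite (gt_eqF r0) implybT.
  by field; exact: lt0r_neq0.
pose u : 'rV[R]_d.+3 := \row_i [:: 0; 0; 1]`_i.
have := planar_waves_bound (u := u) l0 _ adm; rewrite !mxE/= -/L.
have -> : rdot u u = 1.
  rewrite /rdot !big_ord_recl big1 ?addr0 => [|i _]; last first.
    by rewrite !mxE/= nth_nil mul0r.
  by rewrite !mxE/=; ring.
have uL : 0 + L * 0 = 0 by ring.
move=> /(_ uL); rewrite mulrA ler_pdivrMr//.
have -> : torus_cst R d.+3 = ((2 * pi) `^ (d.+3%:R / 2))^-1.
  by rewrite /torus_cst powRN.
rewrite sqrtr1 mulr1 !mulr0 addr0 expr0n mul0r !subr0 mulr1.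
have sq m : (m + 1) / 2 = m / 2 + 2^-1 :> R by field.
by rewrite !sq [1 + _ `^ _]addrC.
Qed.

Theorem proposition9p3 (R : realType) (d : nat) (p n : R)
    (hd : (2 <= d)%N) (hn : d%:R / 2 < n) (hp : n <= p) :
  (forall l : nat, (0 < l)%N -> ((Kminus d p n l)%:E <= Ksharp d p n)%E) /\
  (Kminus_sup d p n <= Ksharp d p n)%E.
Proof.
have bound l : (0 < l)%N -> ((Kminus d p n l)%:E <= Ksharp d p n)%E.
  move=> l0; apply: le_ereal_inf_tmp => _ [K /= adm <-].
  by rewrite lee_fin; exact: Kminus_le_admissible.
split=> //; apply: ge_ereal_sup => _ [l /= l0 <-]; exact: bound.
Qed.
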